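(* Let $f=z(z+\alpha)$ and $A=A(f)$. (1) If $\alpha=0$, every graded simple right $A$-module is isomorphic in $\operatorname{gr}A$ to exactly one of: $X\langle n\rangle$ ($n\in\mathbb{Z}$), $Y\langle n\rangle$ ($n\in\mathbb{Z}$), or $M_\lambda$ ($\lambda\in\Bbbk\setminus\mathbb{Z}$), where $X=A/(xA+zA)$, $Y=(A/(yA+(z-1)A))\langle 1\rangle$, $M_\lambda=A/(z+\lambda)A$. (2) If $\alpha\in\mathbb{Z}_{>0}$, every graded simple right $A$-module is isomorphic to exactly one of: $X\langle n\rangle$, $Y\langle n\rangle$, $Z\langle n\rangle$ ($n\in\mathbb{Z}$), or $M_\lambda$ ($\lambda\in\Bbbk\setminus\mathbb{Z}$), where $X=(A/(xA+(z+\alpha)A))\langle-\alpha\rangle$, $Y=(A/(yA+(z-1)A))\langle1\rangle$, $Z=A/(y^\alpha A+xA+zA)$, $M_\lambda=A/(z+\lambda)A$. (3) If $\alpha\in\Bbbk\setminus\mathbb{Z}$, every graded simple right $A$-module is isomorphic to exactly one of: $X_0\langle n\rangle$, $Y_0\langle n\rangle$, $X_\alpha\langle n\rangle$, $Y_\alpha\langle n\rangle$ ($n\in\mathbb{Z}$), or $M_\lambda$ ($\lambda\in\Bbbk\setminus(\mathbb{Z}\cup(\mathbb{Z}+\alpha))$), where $X_0=A/(xA+zA)$, $Y_0=(A/(yA+(z-1)A))\langle1\rangle$, $X_\alpha=A/(xA+(z+\alpha)A)$, $Y_\alpha=(A/(yA+(z+\alpha-1)A))\langle1\rangle$, $M_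\lambda=A/(z+\lambda)A$.
   Context: $\Bbbk$ is an algebraically closed field of characteristic $0$. Let $\sigma$ be the automorphism of $\Bbbk[z]$ with $\sigma(z)=z+1$. For $\alpha\in\Bbbk$, $f=z(z+\alpha)$ and $A=A(f)$ is the $\Bbbk$-algebra generated by $\Bbbk[z]$, $x$, $y$ with relations $xz=(z+1)x$, $yz=(z-1)y$, $xy=f$, $yx=\sigma^{-1}(f)=(z-1)(z+\alpha-1)$, graded by $\deg x=1,\deg y=-1,\deg z=0$. $\operatorname{gr}A$ is the category of finitely generated $\mathbb{Z}$-graded right $A$-modules with degree-$0$ homomorphisms. For a graded module $M$ the shift $M\langle i\rangle$ is defined by $M\langle i\rangle_j=M_{j-i}$. *)

(* Defs.v *)
From HB Require Import structures.
From mathcomp Require Import all_boot all_order all_algebra.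
Set Implicit Arguments. Unset Strict Implicit. Unset Printing Implicit Defensive.
Import Order.TTheory GRing.Theory Num.Theory.
Local Open Scope ring_scope.

Section GWA.
Variable K : fieldType.
Variable alpha : K.

Definition shiftp (k : int) (p : {poly K}) : {poly K} := p \Po ('X + (k%:~R)%:P).

Definition fpol : {poly K} := 'X * ('X + alpha%:P).

(* Elements of A = A(f), written in normal form  sum_t  (t.2)(z) * w_(t.1),
   where w_n = x^n (n >= 0) and w_n = y^(-n) (n < 0).
   A list represents the (formal) sum of its terms. *)
Definition gwa := seq (int * {poly K}).

Definition gcoef (a : gwa) (n : int) : {poly K} := \sum_(t <- a | t.1 == n) t.2.

(* w_n * w_m = wcoef n m * w_(n+m) *)
Definition wcoef (n m : int) : {poly K} :=
  if (0 <= n) && (0 <= m) then 1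
  else if (n <= 0) && (m <= 0) then 1
  else if 0 < n then
    shiftp (Num.max (n + m) 0) (\prod_(i < minn `|n|%N `|m|%N) shiftp i%:Z fpol)
  else
    shiftp (Num.min (n + m) 0) (\prod_(i < minn `|n|%N `|m|%N) shiftp (- (i.+1)%:Z) fpol).

Definition gmul (a b : gwa) : gwa :=
  [seq (t.1 + s.1, t.2 * shiftp t.1 s.2 * wcoef t.1 s.1) | t <- a, s <- b].

Definition in_rideal (gens : seq gwa) (a : gwa) : Prop :=
  exists ss : seq gwa, size ss = size gens /\
    forall n, gcoef a n = gcoef (flatten [seq gmul rs.1 rs.2 | rs <- zip gens ss]) n.

Definition gx : gwa := [:: (Posz 1%N, 1)].
Definition gy : gwa := [:: (- (Posz 1%N), 1)].
Definition gypow (a : nat) : gwa := [:: (- a%:Z, 1)].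
Definition gzc (c : K) : gwa := [:: (Posz 0%N, 'X + c%:P)].

Definition peval_op (V : lmodType K) (g : V -> V) (p : {poly K}) (v : V) : V :=
  \sum_(i < size p) p`_i *: iter i g v.

(* Z-graded right A(f)-modules: a K-vector space V, homogeneous components
   hom j (j : int) forming a direct sum decomposition of V, and the right
   actions of z, x, y (v |-> v.z, v.x, v.y) *)
Record grmod := GrMod {
  gV : lmodType K;
  ghom : int -> gV -> Prop;
  ghom0 : forall j, ghom j 0;
  ghom_lin : forall j c u v, ghom j u -> ghom j v -> ghom j (c *: u + v);
  gdecomp : forall v, exists s : seq (int * gV),
      uniq (map fst s) /\ (forall t, t \in s -> ghom t.1 t.2) /\ v = \sum_(t <- s) t.2;
  gindep : forall s : seq (int * gV),
      uniq (map fst s) -> (forall t, t \in s -> ghom t.1 t.2) ->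
      \sum_(t <- s) t.2 = 0 -> forall t, t \in s -> t.2 = 0;
  az : gV -> gV;
  ax : gV -> gV;
  ay : gV -> gV;
  az_lin : forall c u v, az (c *: u + v) = c *: az u + az v;
  ax_lin : forall c u v, ax (c *: u + v) = c *: ax u + ax v;
  ay_lin : forall c u v, ay (c *: u + v) = c *: ay u + ay v;
  az_hom : forall j v, ghom j v -> ghom j (az v);
  ax_hom : forall j v, ghom j v -> ghom (j + 1) (ax v);
  ay_hom : forall j v, ghom j v -> ghom (j - 1) (ay v);
  (* xz = (z+1)x,  yz = (z-1)y,  xy = f,  yx = sigma^-1(f) *)
  rel_xz : forall v, az (ax v) = ax (az v + v);
  rel_yz : forall v, az (ay v) = ay (az v - v);
  rel_xy : forall v, ay (ax v) = peval_op az fpol v;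
  rel_yx : forall v, ax (ay v) = peval_op az (shiftp (-1) fpol) v
}.

Variable M : grmod.

Definition actw (n : int) (v : gV M) : gV M :=
  if 0 <= n then iter `|n|%N (@ax M) v else iter `|n|%N (@ay M) v.

Definition act (a : gwa) (v : gV M) : gV M :=
  \sum_(t <- a) actw t.1 (peval_op (@az M) t.2 v).

Definition gsubmod (N : gV M -> Prop) : Prop :=
  N 0 /\ (forall c u v, N u -> N v -> N (c *: u + v)) /\
  (forall v, N v -> N (az v) /\ N (ax v) /\ N (ay v)) /\
  (forall v, N v -> exists s : seq (int * gV M),
      uniq (map fst s) /\ (forall t, t \in s -> ghom t.1 t.2 /\ N t.2) /\
      v = \sum_(t <- s) t.2).

Definition gsimple : Prop :=
  (exists v : gV M, v <> 0) /\
  forall N, gsubmod N -> (forall v, N v -> v = 0) \/ (forall v, N v).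

Definition gfg : Prop :=
  exists s : seq (gV M), (forall v, v \in s -> exists j, ghom j v) /\
    forall v, exists t : seq (gV M * gwa),
      (forall p, p \in t -> p.1 \in s) /\ v = \sum_(p <- t) act p.2 p.1.

(* M is isomorphic in gr A to (A / (r_1 A + ... + r_k A))<n>:
   there is a homogeneous m of degree n such that the degree-0 A-linear map
   A<n> -> M, a |-> m.a, is surjective with kernel r_1 A + ... + r_k A. *)
Definition iso_cyc (gens : seq gwa) (n : int) : Prop :=
  exists m : gV M, ghom n m /\
    (forall v, exists a, v = act a m) /\
    (forall a, act a m = 0 <-> in_rideal gens a).

End GWA.

Definition is_intK (K : fieldType) (c : K) : Prop := exists n : int, c = n%:~R.

Inductive lab1 (K : fieldType) := L1X of int | L1Y of int | L1M of K.
Definition valid1 (K : fieldType) (l : lab1 K) : Prop :=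
  match l with L1M lam => ~ is_intK lam | _ => True end.
Definition iso1 (K : fieldType) (M : grmod 0) (l : lab1 K) : Prop :=
  match l with
  | L1X n => iso_cyc M [:: gx K; gzc 0] n
  | L1Y n => iso_cyc M [:: gy K; gzc (-1)] (n + 1)
  | L1M lam => iso_cyc M [:: gzc lam] 0
  end.

Inductive lab2 (K : fieldType) := L2X of int | L2Y of int | L2Z of int | L2M of K.
Definition valid2 (K : fieldType) (l : lab2 K) : Prop :=
  match l with L2M lam => ~ is_intK lam | _ => True end.
Definition iso2 (K : fieldType) (a : nat) (M : grmod (a%:R : K)) (l : lab2 K) : Prop :=
  match l with
  | L2X n => iso_cyc M [:: gx K; gzc (a%:R)] (n - a%:Z)
  | L2Y n => iso_cyc M [:: gy K; gzc (-1)] (n + 1)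
  | L2Z n => iso_cyc M [:: gypow K a; gx K; gzc 0] n
  | L2M lam => iso_cyc M [:: gzc lam] 0
  end.

Inductive lab3 (K : fieldType) :=
  L3X0 of int | L3Y0 of int | L3Xa of int | L3Ya of int | L3M of K.
Definition valid3 (K : fieldType) (alpha : K) (l : lab3 K) : Prop :=
  match l with L3M lam => ~ is_intK lam /\ ~ is_intK (lam - alpha) | _ => True end.
Definition iso3 (K : fieldType) (alpha : K) (M : grmod alpha) (l : lab3 K) : Prop :=
  match l with
  | L3X0 n => iso_cyc M [:: gx K; gzc 0] n
  | L3Y0 n => iso_cyc M [:: gy K; gzc (-1)] (n + 1)
  | L3Xa n => iso_cyc M [:: gx K; gzc alpha] n
  | L3Ya n => iso_cyc M [:: gy K; gzc (alpha - 1)] (n + 1)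
  | L3M lam => iso_cyc M [:: gzc lam] 0
  end.

(* Main.v *)
(* A graded simple module is generated by any nonzero homogeneous vector, and
   over an algebraically closed field some homogeneous vector is an eigenvector
   of [z], say with eigenvalue [mu].  Acting by [x] (resp. [y]) raises (resp.
   lowers) the eigenvalue by [1], and on an eigenvector of eigenvalue [nu] the
   product [xy] acts by [f(nu)] and [yx] by [f(nu - 1)].  Hence [x] and [y] act
   injectively away from the roots [0] and [-alpha] of [f], whereas at a root
   simplicity forces [x] or [y] to kill the vector.  Moving [mu] along its
   coset [mu + Z] to the nearest root (or to degree [0] when the coset avoids
   the roots) gives a generator whose annihilator is exactly the listed right
   ideal.  Conversely, two generators of one simple module differ in degree by
   the difference of their eigenvalues, and a generator killed by [x] (resp.
   [y]) sits in the top (resp. bottom) degree; in characteristic [0] these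
   constraints tell the listed modules apart. *)

Require Import Defs.
From HB Require Import structures.
From mathcomp Require Import all_boot all_order all_algebra.
From mathcomp Require Import zify ring.
From Stdlib Require Import Classical.
Set Implicit Arguments. Unset Strict Implicit. Unset Printing Implicit Defensive.
Import Order.TTheory GRing.Theory Num.Theory.
Local Open Scope ring_scope.

Section IterLinear.
Variables (K : fieldType) (V : lmodType K) (g : {linear V -> V}).

Lemma iter_is_linear k : linear (iter k g).
Proof. by elim: k => [|k IH] c u v //=; rewrite IH linearP. Qed.

HB.instance Definition _ k :=
  GRing.isLinear.Build K V V *:%R (iter k g) (@iter_is_linear k).

Lemma peval_op_is_linear p : linear (peval_op g p).
Proof.
move=> c u v; rewrite /peval_op scaler_sumr -big_split /=.
by apply: eq_bigr => i _; rewrite linearP scalerDr !scalerA mulrC.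
Qed.

HB.instance Definition _ p :=
  GRing.isLinear.Build K V V *:%R (peval_op g p) (@peval_op_is_linear p).

End IterLinear.

Section PolyEval.
Variables (K : fieldType) (V : lmodType K) (g : {linear V -> V}).
Local Notation pv := (peval_op g).
Implicit Types (p q : {poly K}) (v : V).

Lemma peval_op_size N p v : (size p <= N)%N ->
  pv p v = \sum_(i < N) p`_i *: iter i g v.
Proof.
move=> HN; rewrite /peval_op (big_ord_widen N (fun i => p`_i *: iter i g v)) //.
rewrite big_mkcond; apply: eq_bigr => i _; case: ifP => // /negbT.
by rewrite -leqNgt => Hi; rewrite nth_default // scale0r.
Qed.

Lemma peval_op0 v : pv 0 v = 0.
Proof. by rewrite /peval_op size_poly0 big_ord0. Qed.

Lemma peval_opD p q v : pv (p + q) v = pv p v + pv q v.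
Proof.
pose N := maxn (size p) (size q).
rewrite (@peval_op_size N) ?size_polyD // (@peval_op_size N p) ?leq_maxl //.
rewrite (@peval_op_size N q) ?leq_maxr // -big_split /=.
by apply: eq_bigr => i _; rewrite coefD scalerDl.
Qed.

Lemma peval_opZ c p v : pv (c *: p) v = c *: pv p v.
Proof.
rewrite (@peval_op_size (size p)) ?size_scale_leq // /peval_op scaler_sumr.
by apply: eq_bigr => i _; rewrite coefZ scalerA.
Qed.

Lemma peval_opB p q v : pv (p - q) v = pv p v - pv q v.
Proof. by rewrite peval_opD -[- q]scaleN1r peval_opZ scaleN1r. Qed.

Lemma peval_opMX p v : pv (p * 'X) v = pv p (g v).
Proof.
rewrite (@peval_op_size (size p).+1); last first.
  by case: (eqVneq p 0) => [->|pn0]; rewrite ?mul0r ?size_poly0 // size_mulX.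
rewrite big_ord_recl coefMX /= scale0r add0r /peval_op.
by apply: eq_bigr => i _; rewrite coefMX /= -iterS iterSr.
Qed.

Lemma peval_opC c v : pv c%:P v = c *: v.
Proof. by rewrite (@peval_op_size 1) ?size_polyC ?leq_b1 // big_ord1 coefC. Qed.

Lemma peval_op1 v : pv 1 v = v.
Proof. by rewrite peval_opC scale1r. Qed.

Lemma peval_opX v : pv 'X v = g v.
Proof. by rewrite -(mul1r 'X) peval_opMX peval_op1. Qed.

Lemma peval_op_comm p v : g (pv p v) = pv p (g v).
Proof.
rewrite /peval_op linear_sum; apply: eq_bigr => i _.
by rewrite linearZ -iterS iterSr.
Qed.

Lemma peval_opM p q v : pv (p * q) v = pv p (pv q v).
Proof.
elim/poly_ind: p q v => [|p c IH] q v; first by rewrite mul0r !peval_op0.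
rewrite mulrDl peval_opD -mulrA (mulrC 'X) IH mul_polyC peval_opZ.
by rewrite peval_opD peval_opMX peval_opC peval_opMX peval_op_comm.
Qed.

Lemma peval_op_eigen mu p v : g v = mu *: v -> pv p v = p.[mu] *: v.
Proof.
move=> Hv; have Hi i : iter i g v = mu ^+ i *: v.
  elim: i => [|i IH] /=; first by rewrite scale1r.
  by rewrite IH linearZ /= Hv scalerA -exprSr.
rewrite /peval_op horner_coef scaler_suml; apply: eq_bigr => i _.
by rewrite Hi scalerA.
Qed.

Lemma peval_op_intertwine (h : {linear V -> V}) (d : K) :
  (forall u, g (h u) = h (g u + d *: u)) ->
  forall p u, pv p (h u) = h (pv (p \Po ('X + d%:P)) u).
Proof.
move=> hz p; elim/poly_ind: p => [|p c IH] u.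
  by rewrite comp_poly0 !peval_op0 linear0.
rewrite peval_opD peval_opMX peval_opC hz IH comp_polyD comp_polyM comp_polyX.
rewrite comp_polyC mulrDr (mulrC _ d%:P) mul_polyC !peval_opD peval_opMX.
by rewrite peval_opZ peval_opC !linearD !linearZ.
Qed.

End PolyEval.

Section Shift.
Variable K : fieldType.
Implicit Types p q : {poly K}.

Lemma horner_shiftp (k : int) p (x : K) : (shiftp k p).[x] = p.[x + k%:~R].
Proof. by rewrite /shiftp horner_comp !hornerE. Qed.

Lemma shiftp_comp (a b : int) p : shiftp a (shiftp b p) = shiftp (a + b) p.
Proof.
rewrite /shiftp -comp_polyA comp_polyD comp_polyX comp_polyC -addrA -polyCD.
by rewrite intrD addrC.
Qed.

Lemma shiftp0 p : shiftp 0 p = p.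
Proof. by rewrite /shiftp addr0 comp_polyXr. Qed.

Lemma shiftpK (a : int) p : shiftp (- a) (shiftp a p) = p.
Proof. by rewrite shiftp_comp addNr shiftp0. Qed.

Lemma shiftpKV (a : int) p : shiftp a (shiftp (- a) p) = p.
Proof. by rewrite shiftp_comp addrN shiftp0. Qed.

Lemma shiftp1 (a : int) : shiftp a 1 = 1 :> {poly K}.
Proof. by rewrite /shiftp comp_polyC. Qed.

End Shift.

Section GradedModule.
Variables (K : fieldType) (alpha : K) (M : grmod alpha).
Local Notation V := (gV M).
Local Notation pv := (peval_op (@az _ _ M)).

HB.instance Definition _ :=
  GRing.isLinear.Build K V V *:%R (@az _ _ M) (fun c u v => @az_lin _ _ M c u v).
HB.instance Definition _ :=
  GRing.isLinear.Build K V V *:%R (@ax _ _ M) (fun c u v => @ax_lin _ _ M c u v).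
HB.instance Definition _ :=
  GRing.isLinear.Build K V V *:%R (@ay _ _ M) (fun c u v => @ay_lin _ _ M c u v).

Lemma ghomD j (u v : V) : ghom j u -> ghom j v -> ghom j (u + v).
Proof. by move=> Hu Hv; rewrite -(scale1r u); apply: ghom_lin. Qed.

Lemma ghomZ j c (u : V) : ghom j u -> ghom j (c *: u).
Proof. by move=> Hu; rewrite -(addr0 (c *: u)); apply: ghom_lin => //; apply: ghom0. Qed.

Lemma ghom_sum j I (s : seq I) (P : pred I) (F : I -> V) :
  (forall i, P i -> ghom j (F i)) -> ghom j (\sum_(i <- s | P i) F i).
Proof.
move=> H; elim: s => [|i s IH]; first by rewrite big_nil; apply: ghom0.
by rewrite big_cons; case: ifP => // Pi; apply: ghomD => //; apply: H.
Qed.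

Lemma peval_op_ghom j p (v : V) : ghom j v -> ghom j (pv p v).
Proof.
move=> Hv; apply: ghom_sum => i _; apply: ghomZ.
by elim: (i : nat) => //= k IH; apply: az_hom.
Qed.

Lemma iter_ax_ghom j k (v : V) : ghom j v -> ghom (j + k%:Z) (iter k (@ax _ _ M) v).
Proof.
move=> Hv; elim: k => [|k IH] /=; first by rewrite addr0.
by rewrite -[k.+1]addn1 PoszD addrA; apply: ax_hom.
Qed.

Lemma iter_ay_ghom j k (v : V) : ghom j v -> ghom (j - k%:Z) (iter k (@ay _ _ M) v).
Proof.
move=> Hv; elim: k => [|k IH] /=; first by rewrite subr0.
by rewrite -[k.+1]addn1 PoszD opprD addrA; apply: ay_hom.
Qed.

Lemma actw_is_linear n : linear (@actw _ _ M n).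
Proof.
by case: n => k c u v; [exact: (linearP (iter k (@ax _ _ M))) |
                        exact: (linearP (iter k.+1 (@ay _ _ M)))].
Qed.

HB.instance Definition _ n :=
  GRing.isLinear.Build K V V *:%R (@actw _ _ M n) (@actw_is_linear n).

Lemma actwP (k : nat) (v : V) : actw k v = iter k (@ax _ _ M) v.
Proof. by []. Qed.

Lemma actwN (k : nat) (v : V) : actw (- k%:Z) v = iter k (@ay _ _ M) v.
Proof. by case: k. Qed.

Lemma actw_ghom j n (v : V) : ghom j v -> ghom (j + n) (actw n v).
Proof.
case: n => k Hv; first exact: iter_ax_ghom.
by rewrite NegzE actwN; apply: iter_ay_ghom.
Qed.

Lemma az_iter_ax k (u : V) :
  az (iter k (@ax _ _ M) u) = iter k (@ax _ _ M) (az u + k%:R *: u).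
Proof.
elim: k => [|k IH] /=; first by rewrite scale0r addr0.
by rewrite rel_xz IH -linearD -natr1 scalerDl scale1r addrA.
Qed.

Lemma az_iter_ay k (u : V) :
  az (iter k (@ay _ _ M) u) = iter k (@ay _ _ M) (az u - k%:R *: u).
Proof.
elim: k => [|k IH] /=; first by rewrite scale0r subr0.
by rewrite rel_yz IH -linearB -natr1 scalerDl scale1r opprD addrA.
Qed.

Lemma az_actw n (u : V) : az (actw n u) = actw n (az u + n%:~R *: u).
Proof.
case: n => k; first exact: az_iter_ax.
by rewrite -[Negz k]opprK NegzE !actwN az_iter_ay mulrNz scaleNr opprK.
Qed.

Lemma peval_op_actw n p (u : V) : pv p (actw n u) = actw n (pv (shiftp n p) u).
Proof. exact: (peval_op_intertwine (az_actw n)). Qed.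

Lemma az_actw_eigen mu n (u : V) : az u = mu *: u ->
  az (actw n u) = (mu + n%:~R) *: actw n u.
Proof. by move=> Hu; rewrite az_actw Hu -scalerDl linearZ. Qed.

Lemma az_iter_ax_eigen mu k (u : V) : az u = mu *: u ->
  az (iter k (@ax _ _ M) u) = (mu + k%:R) *: iter k (@ax _ _ M) u.
Proof. exact: (@az_actw_eigen mu k). Qed.

Lemma az_iter_ay_eigen mu k (u : V) : az u = mu *: u ->
  az (iter k (@ay _ _ M) u) = (mu - k%:R) *: iter k (@ay _ _ M) u.
Proof. by move=> Hu; rewrite az_iter_ay Hu -scalerBl linearZ. Qed.

End GradedModule.

Section Gcoef.
Variable K : fieldType.
Implicit Types a b : gwa K.

Lemma gcoef_nil n : gcoef ([::] : gwa K) n = 0.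
Proof. by rewrite /gcoef big_nil. Qed.

Lemma gcoef_cons t a n : gcoef (t :: a) n = (if t.1 == n then t.2 else 0) + gcoef a n.
Proof. by rewrite /gcoef big_cons; case: ifP; rewrite ?add0r. Qed.

Lemma gcoef_cat a b n : gcoef (a ++ b) n = gcoef a n + gcoef b n.
Proof. by rewrite /gcoef big_cat. Qed.

Lemma gcoef_notin a n : n \notin map fst a -> gcoef a n = 0.
Proof.
move=> Hn; rewrite /gcoef big_seq_cond big1 // => t /andP [ta /eqP tn].
by move: Hn; rewrite -tn map_f.
Qed.

Lemma gcoef_map (S : seq int) (G : int -> {poly K}) n : uniq S ->
  gcoef [seq (j, G j) | j <- S] n = if n \in S then G n else 0.
Proof.
elim: S => [|j S IH] /=; first by rewrite gcoef_nil.
case/andP=> jS uS; rewrite gcoef_cons IH // in_cons.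
case: (eqVneq j n) => [<-|jn] /=; last by rewrite add0r.
by rewrite (negbTE jS) addr0.
Qed.

Lemma sum_gcoef (V : zmodType) (F : int -> {poly K} -> V) a (S : seq int) :
  (forall j, F j 0 = 0) -> (forall j, {morph F j : p q / p + q}) ->
  uniq S -> {subset map fst a <= S} ->
  \sum_(t <- a) F t.1 t.2 = \sum_(j <- S) F j (gcoef a j).
Proof.
move=> F0 FD uS; elim: a => [|t a IH] sub /=.
  by rewrite big_nil big1 // => j _; rewrite gcoef_nil F0.
rewrite big_cons IH; last by move=> x xa; apply: sub; rewrite in_cons xa orbT.
under [in RHS]eq_bigr => j _ do rewrite gcoef_cons FD.
rewrite big_split /=; congr (_ + _).
have tS : t.1 \in S by apply: sub; rewrite in_cons eqxx.
rewrite (bigD1_seq t.1) //= eqxx big1 ?addr0 // => j jt.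
by rewrite eq_sym (negbTE jt) F0.
Qed.

End Gcoef.

Section Action.
Variables (K : fieldType) (alpha : K) (M : grmod alpha).
Local Notation V := (gV M).
Local Notation pv := (peval_op (@az _ _ M)).
Local Notation f := (fpol alpha).
Implicit Types a b : gwa K.

Lemma act_is_linear a : linear (@act _ _ M a).
Proof.
move=> c u v; rewrite /act scaler_sumr -big_split /=.
by apply: eq_bigr => t _; rewrite !linearP.
Qed.

HB.instance Definition _ a :=
  GRing.isLinear.Build K V V *:%R (@act _ _ M a) (@act_is_linear a).

Lemma act_nil (w : V) : act [::] w = 0.
Proof. by rewrite /act big_nil. Qed.

Lemma act_cons t a (w : V) : act (t :: a) w = actw t.1 (pv t.2 w) + act a w.
Proof. by rewrite /act big_cons. Qed.

Lemma act_cat a b (w : V) : act (a ++ b) w = act a w + act b w.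
Proof. by rewrite /act big_cat. Qed.

Lemma act_single (j : int) p (w : V) : act [:: (j, p)] w = actw j (pv p w).
Proof. by rewrite act_cons act_nil addr0. Qed.

Lemma act_unit (w : V) : act [:: (0, 1)] w = w.
Proof. by rewrite act_single peval_op1. Qed.

Lemma act_by_degree a (w : V) (S : seq int) : uniq S -> {subset map fst a <= S} ->
  act a w = \sum_(j <- S) actw j (pv (gcoef a j) w).
Proof.
move=> uS sub; rewrite /act (@sum_gcoef _ _ (fun j p => actw j (pv p w)) a S) //.
  by move=> j; rewrite peval_op0 linear0.
by move=> j p q; rewrite peval_opD linearD.
Qed.

Lemma act_scale c a (w : V) : act [seq (t.1, c *: t.2) | t <- a] w = c *: act a w.
Proof.
rewrite /act big_map scaler_sumr; apply: eq_bigr => t _ /=.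
by rewrite peval_opZ linearZ.
Qed.

Lemma az_act a (w : V) :
  az (act a w) = act [seq (t.1, shiftp t.1 'X * t.2) | t <- a] w.
Proof.
rewrite /act big_map linear_sum; apply: eq_bigr => t _ /=.
by rewrite -peval_opX peval_op_actw peval_opM.
Qed.

(* Moving [x] (resp. [y]) past [w_j] produces the factor [xcoef j]
   (resp. [ycoef j]) coming from the relations [yx = sigma^-1(f)], [xy = f]. *)
Definition xcoef (j : int) : {poly K} := if 0 <= j then 1 else shiftp j f.
Definition ycoef (j : int) : {poly K} := if 0 < j then shiftp (j - 1) f else 1.

Lemma ax_actw j (u : V) : ax (actw j u) = actw (j + 1) (pv (xcoef j) u).
Proof.
rewrite /xcoef; case: j => k /=.
  by rewrite peval_op1 -PoszD addn1.
rewrite /actw /= rel_yx.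
have -> : iter k (@ay _ _ M) u = actw (Negz k + 1) u.
  by rewrite (_ : Negz k + 1 = - k%:Z) ?actwN // NegzE; lia.
by rewrite peval_op_actw shiftp_comp addrK.
Qed.

Lemma ay_actw j (u : V) : ay (actw j u) = actw (j - 1) (pv (ycoef j) u).
Proof.
rewrite /ycoef; case: j => [[|k]|k] /=.
- by rewrite peval_op1.
- rewrite actwP /= rel_xy (_ : Posz k.+1 - 1 = k); last by lia.
  by rewrite -actwP peval_op_actw.
- by rewrite peval_op1 (_ : Negz k - 1 = Negz k.+1) // !NegzE; lia.
Qed.

Lemma ax_act a (w : V) :
  ax (act a w) = act [seq (t.1 + 1, xcoef t.1 * t.2) | t <- a] w.
Proof.
rewrite /act big_map linear_sum; apply: eq_bigr => t _ /=.
by rewrite ax_actw peval_opM.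
Qed.

Lemma ay_act a (w : V) :
  ay (act a w) = act [seq (t.1 - 1, ycoef t.1 * t.2) | t <- a] w.
Proof.
rewrite /act big_map linear_sum; apply: eq_bigr => t _ /=.
by rewrite ay_actw peval_opM.
Qed.

End Action.

Section Simple.
Variables (K : fieldType) (alpha : K) (M : grmod alpha).
Local Notation V := (gV M).
Local Notation pv := (peval_op (@az _ _ M)).
Local Notation f := (fpol alpha).
Implicit Types a b : gwa K.

Definition cyclic_span (w : V) : V -> Prop := fun v => exists a, v = act a w.

Lemma gsubmod_cyclic_span n (w : V) : ghom n w -> gsubmod (cyclic_span w).
Proof.
move=> Hw; split; first by exists [::]; rewrite act_nil.
split.
  move=> c u v [a ->] [b ->]; exists ([seq (t.1, c *: t.2) | t <- a] ++ b).
  by rewrite act_cat act_scale.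
split.
  move=> v [a ->]; split; first by eexists; apply: az_act.
  by split; eexists; [apply: ax_act | apply: ay_act].
move=> v [a ->]; pose S := undup (map fst a).
exists [seq (n + j, actw j (pv (gcoef a j) w)) | j <- S]; split.
  by rewrite -map_comp (map_inj_uniq (addrI n)) ?undup_uniq.
split.
  move=> t /mapP [j jS ->] /=; split; first by apply: actw_ghom; apply: peval_op_ghom.
  by exists [:: (j, gcoef a j)]; rewrite act_single.
rewrite big_map; apply: act_by_degree; first exact: undup_uniq.
by move=> x; rewrite mem_undup.
Qed.

Lemma act_homogeneous_component n j a (w v : V) : ghom n w -> v = act a w ->
  ghom (n + j) v -> v = actw j (pv (gcoef a j) w).
Proof.
move=> Hw Hv Hvj; pose S := undup (j :: map fst a).
have uS : uniq S by apply: undup_uniq.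
have jS : j \in S by rewrite mem_undup in_cons eqxx.
pose C i := actw i (pv (gcoef a i) w).
have HA : v = \sum_(i <- S) C i.
  by rewrite Hv; apply: act_by_degree => // x xa; rewrite mem_undup in_cons xa orbT.
pose s := [seq (n + i, C i - (if i == j then v else 0)) | i <- S].
have us : uniq (map fst s) by rewrite -map_comp (map_inj_uniq (addrI n)).
have hs t : t \in s -> ghom t.1 t.2.
  case/mapP=> i iS -> /=; apply: ghomD; first by apply: actw_ghom; apply: peval_op_ghom.
  by rewrite -scaleN1r; apply: ghomZ; case: eqP => [->|_] //; apply: ghom0.
have s0 : \sum_(t <- s) t.2 = 0.
  rewrite big_map sumrB -HA (bigD1_seq j) //= eqxx big1 ?addr0 ?subrr //.
  by move=> i /negbTE ->.
have js : (n + j, C j - v) \in s by apply/mapP; exists j; rewrite ?eqxx.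
by have /eqP := gindep us hs s0 js; rewrite subr_eq0 => /eqP.
Qed.

Lemma simple_generated n (w : V) : gsimple M -> ghom n w -> w <> 0 ->
  forall v, exists a, v = act a w.
Proof.
move=> [_ Hs] Hw w0 v; case: (Hs _ (gsubmod_cyclic_span Hw)) => [H|]; last exact.
by exfalso; apply: w0; apply: H; exists [:: (0, 1)]; rewrite act_unit.
Qed.

Lemma act_eq0_eigen n mu (w : V) a : ghom n w -> az w = mu *: w ->
  act a w = 0 <-> forall j, (gcoef a j).[mu] *: actw j w = 0.
Proof.
move=> Hw Hmu; split.
  move=> H0 j; have := act_homogeneous_component (j := j) Hw (esym H0) (ghom0 _ _).
  by rewrite (peval_op_eigen _ Hmu) linearZ.
move=> H; rewrite (@act_by_degree _ _ _ a w (undup (map fst a))) ?undup_uniq //; last first.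
  by move=> x; rewrite mem_undup.
by rewrite big1 // => j _; rewrite (peval_op_eigen _ Hmu) linearZ; apply: H.
Qed.

Lemma iter_ax_neq0 mu k (u : V) : u <> 0 -> az u = mu *: u ->
  (forall i, (i < k)%N -> f.[mu + i%:R] <> 0) -> iter k (@ax _ _ M) u <> 0.
Proof.
move=> u0 Hu; elim: k => [|k IH] Hf //=.
have IH' := IH (fun i Hi => Hf i (ltnW Hi)).
move=> H0; have := rel_xy (iter k (@ax _ _ M) u); rewrite H0 linear0.
rewrite (peval_op_eigen _ (az_iter_ax_eigen _ Hu)) => /esym /eqP.
by rewrite scaler_eq0 => /orP [/eqP /(Hf k (ltnSn k))|/eqP /IH'].
Qed.

Lemma iter_ay_neq0 mu k (u : V) : u <> 0 -> az u = mu *: u ->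
  (forall i, (i < k)%N -> f.[mu - i%:R - 1] <> 0) -> iter k (@ay _ _ M) u <> 0.
Proof.
move=> u0 Hu; elim: k => [|k IH] Hf //=.
have IH' := IH (fun i Hi => Hf i (ltnW Hi)).
move=> H0; have := rel_yx (iter k (@ay _ _ M) u); rewrite H0 linear0.
rewrite (peval_op_eigen _ (az_iter_ay_eigen _ Hu)) horner_shiftp => /esym /eqP.
by rewrite scaler_eq0 => /orP [/eqP /(Hf k (ltnSn k))|/eqP /IH'].
Qed.

Lemma simple_actw_neq0 n j (w u : V) mu : gsimple M -> w <> 0 -> ghom n w ->
  az w = mu *: w -> u <> 0 -> ghom (n + j) u -> actw j w <> 0.
Proof.
move=> Hs w0 Hw Hmu u0 Hu H0; have [a Ha] := simple_generated Hs Hw w0 u.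
have := act_homogeneous_component Hw Ha Hu.
by rewrite (peval_op_eigen _ Hmu) linearZ /= H0 scaler0.
Qed.

Lemma simple_ax_eq0 d mu (u : V) : gsimple M -> u <> 0 -> ghom d u ->
  az u = mu *: u -> f.[mu] = 0 -> ax u = 0.
Proof.
move=> Hs u0 Hu Hmu Hf; case: (eqVneq (ax u) 0) => // /eqP w0; exfalso.
have Hz : az (ax u) = (mu + 1) *: ax u := az_iter_ax_eigen 1 Hmu.
have Hu' : ghom (d + 1 + -1) u by rewrite addrK.
apply: (simple_actw_neq0 Hs w0 (ax_hom Hu) Hz u0 Hu').
by rewrite (_ : actw (-1) (ax u) = ay (ax u)) // rel_xy (peval_op_eigen _ Hmu) Hf scale0r.
Qed.

Lemma simple_ay_eq0 d mu (u : V) : gsimple M -> u <> 0 -> ghom d u ->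
  az u = mu *: u -> f.[mu - 1] = 0 -> ay u = 0.
Proof.
move=> Hs u0 Hu Hmu Hf; case: (eqVneq (ay u) 0) => // /eqP w0; exfalso.
have Hz : az (ay u) = (mu - 1) *: ay u := az_iter_ay_eigen 1 Hmu.
have Hu' : ghom (d - 1 + 1) u by rewrite subrK.
apply: (simple_actw_neq0 Hs w0 (ay_hom Hu) Hz u0 Hu').
by rewrite actwP /= rel_yx (peval_op_eigen _ Hmu) horner_shiftp Hf scale0r.
Qed.

Lemma simple_iter_ay_eq0 d (k : nat) (u : V) : gsimple M -> u <> 0 -> ghom d u ->
  az u = 0 -> f.[- k%:R] = 0 -> (0 < k)%N -> iter k (@ay _ _ M) u = 0.
Proof.
move=> Hs u0 Hu Hz Hf k0.
case: (eqVneq (iter k (@ay _ _ M) u) 0) => // /eqP w0; exfalso.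
have Hz' : az (iter k (@ay _ _ M) u) = - k%:R *: iter k (@ay _ _ M) u.
  by rewrite (@az_iter_ay_eigen _ _ _ 0) ?scale0r // sub0r.
have Hw := iter_ay_ghom k Hu.
have Hu' : ghom (d - k%:Z + k%:Z) u by rewrite subrK.
apply: (simple_actw_neq0 Hs w0 Hw Hz' u0 Hu').
have Hx := simple_ax_eq0 Hs w0 Hw Hz' Hf.
rewrite actwP; case: k k0 Hx {Hw Hz' Hf w0 Hu'} => // k _ Hx.
by rewrite iterSr Hx linear0.
Qed.

Lemma exists_ghom_neq0 (v : V) : v <> 0 -> exists d (u : V), u <> 0 /\ ghom d u.
Proof.
move=> v0; have [s [_ [Hs Hv]]] := gdecomp v.
case: (boolP (all (fun t => t.2 == 0) s)) => [/allP Hall|].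
  by exfalso; apply: v0; rewrite Hv big1_seq // => t ts; apply/eqP; apply: Hall.
by case/allPn => t ts /eqP t0; exists t.1, t.2; split => //; apply: Hs.
Qed.

End Simple.

Section ClosedField.
Variables (K : closedFieldType) (alpha : K) (M : grmod alpha).
Local Notation V := (gV M).
Local Notation pv := (peval_op (@az _ _ M)).

Lemma eigen_of_split_annihilator d (rs : seq K) (v : V) : v <> 0 -> ghom d v ->
  pv (\prod_(z <- rs) ('X - z%:P)) v = 0 ->
  exists (u : V) mu, [/\ u <> 0, ghom d u & az u = mu *: u].
Proof.
elim: rs v => [|z rs IH] v v0 Hv; first by rewrite big_nil peval_op1.
rewrite big_cons peval_opM.
case: (eqVneq (pv (\prod_(j <- rs) ('X - j%:P)) v) 0) => [H0 _|/eqP H0 H].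
  exact: IH v0 Hv H0.
exists (pv (\prod_(j <- rs) ('X - j%:P)) v), z; split => //; first exact: peval_op_ghom.
by move/eqP: H; rewrite peval_opB peval_opX peval_opC subr_eq0 => /eqP.
Qed.

(* If [v.z <> 0] then [v.z] generates, so [v = v.z.p(z)] for some [p]: the
   nonzero polynomial [1 - pX], which splits over [K], annihilates [v]. *)
Lemma simple_exists_eigen : gsimple M ->
  exists (u : V) d mu, [/\ u <> 0, ghom d u & az u = mu *: u].
Proof.
move=> Hs; have [[v0 v00] _] := Hs.
have [d [v [v0n Hv]]] := exists_ghom_neq0 v00.
case: (eqVneq (az v) 0) => [Hz|Hz].
  by exists v, d, 0; rewrite scale0r.
have Hw : ghom d (az v) by apply: az_hom.
have [a Ha] := simple_generated Hs Hw (elimN eqP Hz) v.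
have := act_homogeneous_component (j := 0) Hw Ha; rewrite addr0 => /(_ Hv) Hv'.
rewrite actwP /= -peval_opMX in Hv'.
set g := 1 - gcoef a 0 * 'X.
have Hg : pv g v = 0 by rewrite peval_opB peval_op1 -Hv' subrr.
have g0 : g != 0.
  apply/eqP => /(congr1 (horner^~ 0)).
  by rewrite /g !hornerE subr0 => /eqP; rewrite oner_eq0.
have [rs Hrs] := closed_field_poly_normal g.
move: Hg; rewrite Hrs peval_opZ => /eqP; rewrite scaler_eq0 lead_coef_eq0 (negbTE g0) /=.
by move=> /eqP /(eigen_of_split_annihilator v0n Hv) [u [mu Hu]]; exists u, d, mu.
Qed.

End ClosedField.

Section RightIdeal.
Variables (K : fieldType) (alpha : K).
Local Notation f := (fpol alpha).
Implicit Types a b : gwa K.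

Lemma gmul_single (t : int * {poly K}) b :
  gmul alpha [:: t] b = [seq (t.1 + s.1, t.2 * shiftp t.1 s.2 * wcoef alpha t.1 s.1) | s <- b].
Proof. by rewrite /gmul /= cats0. Qed.

Lemma gmul0 a : gmul alpha a [::] = [::].
Proof. by elim: a. Qed.

Lemma gcoef_gmul_map (k : int) (p : {poly K}) (S : seq int) (F : int -> {poly K}) n :
  uniq S ->
  gcoef (gmul alpha [:: (k, p)] [seq (j - k, F j) | j <- S]) n =
  if n \in S then p * shiftp k (F n) * wcoef alpha k (n - k) else 0.
Proof.
move=> uS; rewrite gmul_single -map_comp /=.
rewrite (eq_map (g := fun j => (j, p * shiftp k (F j) * wcoef alpha k (j - k)))).
  exact: gcoef_map.
by move=> j /=; rewrite addrC subrK.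
Qed.

Lemma wcoef_pp (m n : int) : 0 <= m -> 0 <= n -> wcoef alpha m n = 1.
Proof. by move=> Hm Hn; rewrite /wcoef Hm Hn. Qed.

Lemma wcoef_nn (m n : int) : m <= 0 -> n <= 0 -> wcoef alpha m n = 1.
Proof.
move=> Hm Hn; rewrite /wcoef Hm Hn /=.
by case: ifP => // /andP [H1 _]; rewrite (@le_anti _ _ m 0) ?H1 ?Hm.
Qed.

Lemma wcoef0l (n : int) : wcoef alpha 0 n = 1.
Proof. by case: (lerP 0 n) => H; [apply: wcoef_pp | apply: wcoef_nn => //; apply: ltW]. Qed.

Lemma wcoef0r (k : int) : wcoef alpha k 0 = 1.
Proof. by case: (lerP 0 k) => H; [apply: wcoef_pp | apply: wcoef_nn => //; apply: ltW]. Qed.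

Lemma wcoef1N (k : nat) : wcoef alpha 1 (Negz k) = f.
Proof.
rewrite /wcoef /=; have -> : minn 1 k.+1 = 1%N by apply/minn_idPl.
by rewrite max_r ?big_ord1 ?shiftp0 // NegzE; lia.
Qed.

Lemma wcoefN1P (k : nat) : wcoef alpha (-1) k.+1 = shiftp (-1) f.
Proof.
rewrite /wcoef /=; have -> : minn 1 k.+1 = 1%N by apply/minn_idPl.
by rewrite min_r ?big_ord1 ?shiftp0 //; lia.
Qed.

(* [y^(a+1) x^(k+1)] is a product of shifts of [f], one of which is
   [sigma^(-a-1) f], so it vanishes at [0] when [f] vanishes at [-(a+1)]. *)
Lemma wcoefNP_root (a k : nat) :
  f.[- (a.+1)%:R] = 0 -> (wcoef alpha (Negz a) k.+1).[0] = 0.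
Proof.
move=> Hf; rewrite /wcoef /=.
have [N HN] : exists N, minn a.+1 k.+1 = N.+1.
  by exists (minn a.+1 k.+1).-1; rewrite prednK // leq_min.
rewrite HN horner_shiftp horner_prod big_ord_recr /= horner_shiftp add0r -intrD.
have -> : Num.min (Negz a + Posz k.+1) 0 - (N.+1)%:Z = - (a.+1)%:Z by rewrite NegzE; lia.
by rewrite mulrNz Hf mulr0.
Qed.

Lemma in_rideal_cons g gs a : in_rideal alpha gs a -> in_rideal alpha (g :: gs) a.
Proof.
move=> [ss [Hsz Hss]]; exists ([::] :: ss); split; first by rewrite /= Hsz.
by move=> n; rewrite Hss /= gmul0.
Qed.

Lemma in_rideal_head (t : int * {poly K}) gs : in_rideal alpha ([:: t] :: gs) [:: t].
Proof.
exists ([:: (0, 1)] :: nseq (size gs) [::]); split; first by rewrite /= size_nseq.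
move=> n /=.
have -> : flatten [seq gmul alpha rs.1 rs.2 | rs <- zip gs (nseq (size gs) [::])] = [::].
  by elim: gs => //= g gs ->; rewrite gmul0.
by rewrite addr0 shiftp1 wcoef0r !mulr1; case: t.
Qed.

End RightIdeal.

Lemma mulXaddC_divp (K : fieldType) (q : {poly K}) (c : K) :
  q.[- c] = 0 -> ('X + c%:P) * (q %/ ('X + c%:P)) = q.
Proof.
move=> Hq; have -> : 'X + c%:P = 'X - (- c)%:P by rewrite polyCN opprK.
by apply: divpKC; rewrite dvdp_XsubCl /root Hq.
Qed.

Section IdealKillsEigenvector.
Variables (K : fieldType) (alpha : K) (V : lmodType K) (e : int -> V) (mu : K).

(* [e j] stands for [u.w_j], with [u] a [z]-eigenvector of eigenvalue [mu]; the
   condition says that every product [t (q w_j)], i.e. the right ideal [tA],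
   kills [u]. *)
Definition kills_monomial (t : int * {poly K}) :=
  forall j q, (t.2 * shiftp t.1 q * wcoef alpha t.1 j).[mu] *: e (t.1 + j) = 0.

Lemma in_rideal_kills gens a :
  (forall g, g \in gens -> exists t, g = [:: t] /\ kills_monomial t) ->
  in_rideal alpha gens a -> forall j, (gcoef a j).[mu] *: e j = 0.
Proof.
move=> Hg [ss [_ Hss]] j; rewrite Hss {Hss}.
elim: gens ss Hg => [|g gs IH] [|s ss] Hg /=; rewrite ?gcoef_nil ?horner0 ?scale0r //.
rewrite gcoef_cat hornerD scalerDl IH; last by move=> h hh; apply: Hg; rewrite in_cons hh orbT.
have [t [-> Ht]] := Hg g (mem_head _ _); rewrite addr0 gmul_single.
elim: s => [|u s IHs] /=; first by rewrite gcoef_nil horner0 scale0r.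
rewrite gcoef_cons hornerD scalerDl IHs addr0; case: eqP => [<-|_]; first exact: Ht.
by rewrite horner0 scale0r.
Qed.

End IdealKillsEigenvector.

Section Presentations.
Variables (K : fieldType) (alpha : K) (M : grmod alpha).
Local Notation V := (gV M).
Local Notation f := (fpol alpha).
Local Notation kills u mu := (kills_monomial alpha (fun j => actw j u) mu).
Implicit Types a b : gwa K.

Lemma kills_gzc c (u : V) : kills u (- c) (0, 'X + c%:P).
Proof. by move=> j q /=; rewrite !hornerM hornerD hornerX hornerC addNr !mul0r scale0r. Qed.

Lemma kills_gx mu (u : V) : ax u = 0 -> f.[mu] = 0 -> kills u mu (1, 1).
Proof.
move=> Hx Hf [k|k] q /=.
  rewrite addrC (_ : Posz k + 1 = k.+1); last by lia.
  by rewrite actwP iterSr Hx linear0 scaler0.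
by rewrite wcoef1N hornerM Hf mulr0 scale0r.
Qed.

Lemma kills_gy mu (u : V) : ay u = 0 -> f.[mu - 1] = 0 -> kills u mu (-1, 1).
Proof.
move=> Hy Hf [[|k]|k] q /=.
- by rewrite addr0 (_ : actw (-1) u = ay u) // Hy scaler0.
- by rewrite wcoefN1P hornerM horner_shiftp Hf mulr0 scale0r.
- rewrite addrC (_ : Negz k + -1 = Negz k.+1); last by rewrite !NegzE; lia.
  by rewrite [actw _ _]iterSr Hy linear0 scaler0.
Qed.

Lemma kills_gypow (k : nat) (u : V) : (0 < k)%N -> iter k (@ay _ _ M) u = 0 ->
  f.[- k%:R] = 0 -> kills u 0 (- k%:Z, 1).
Proof.
move=> k0 Hy Hf j q /=; case: (lerP j 0) => Hj.
  rewrite (_ : - k%:Z + j = - (`|j| + k)%N%:Z); last by lia.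
  by rewrite actwN iterD Hy linear0 scaler0.
rewrite (_ : j = `|j|.-1.+1); last by lia.
case: k k0 Hy Hf => // k _ Hy Hf.
by rewrite -NegzE hornerM wcoefNP_root // mulr0 scale0r.
Qed.

Lemma iso_cyc_eigen gens n mu (u : V) : gsimple M -> u <> 0 -> ghom n u ->
  az u = mu *: u -> (forall g, g \in gens -> exists t, g = [:: t] /\ kills u mu t) ->
  (forall a, (forall j, (gcoef a j).[mu] *: actw j u = 0) -> in_rideal alpha gens a) ->
  iso_cyc M gens n.
Proof.
move=> Hs u0 Hu Hz Hgens Hideal; exists u; split => //.
split; first exact: simple_generated Hs Hu u0.
move=> a; rewrite (act_eq0_eigen a Hu Hz); split; first exact: Hideal.
exact: in_rideal_kills.
Qed.

(* An annihilating [a] has its coefficients of degree [<= 0] vanishing at [-c],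
   so they are multiples of [z + c]; the others are left multiples of [x]. *)
Lemma iso_cyc_gx c n (u : V) : gsimple M -> u <> 0 -> ghom n u ->
  az u = (- c) *: u -> ax u = 0 -> f.[- c] = 0 ->
  (forall i : nat, f.[- c - i%:R - 1] <> 0) -> iso_cyc M [:: gx K; gzc c] n.
Proof.
move=> Hs u0 Hu Hz Hx Hf Hnz; apply: (iso_cyc_eigen Hs u0 Hu Hz).
  move=> g; rewrite !inE => /orP [] /eqP ->; eexists; split; try reflexivity.
    exact: kills_gx.
  exact: kills_gzc.
move=> a H.
have Hnonpos j : j <= 0 -> (gcoef a j).[- c] = 0.
  move=> Hj; have /eqP := H j; rewrite scaler_eq0 => /orP [/eqP //|/eqP H0].
  exfalso; move: H0; rewrite (_ : j = - `|j|%N%:Z) ?actwN; last by lia.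
  by apply: (iter_ay_neq0 u0 Hz) => i _; apply: Hnz.
pose S := undup (map fst a).
exists [:: [seq (j - 1, shiftp (-1) (gcoef a j)) | j <- [seq j <- S | 0 < j]];
           [seq (j - 0, gcoef a j %/ ('X + c%:P)) | j <- [seq j <- S | j <= 0]]].
split => // m; rewrite /= !gcoef_cat gcoef_nil !addr0.
rewrite -!gmul_single !gcoef_gmul_map ?filter_uniq ?undup_uniq // !mem_filter.
case: (boolP (m \in S)) => mS; last first.
  by rewrite !andbF add0r gcoef_notin // -mem_undup.
rewrite !andbT; case: (ltrP 0 m) => Hm.
  by rewrite addr0 shiftpKV wcoef_pp ?mulr1 ?mul1r //; lia.
by rewrite add0r shiftp0 subr0 wcoef_nn // mulr1 mulXaddC_divp // Hnonpos.
Qed.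

Lemma iso_cyc_gy c n (u : V) : gsimple M -> u <> 0 -> ghom n u ->
  az u = (- c) *: u -> ay u = 0 -> f.[- c - 1] = 0 ->
  (forall i : nat, f.[- c + i%:R] <> 0) -> iso_cyc M [:: gy K; gzc c] n.
Proof.
move=> Hs u0 Hu Hz Hy Hf Hnz; apply: (iso_cyc_eigen Hs u0 Hu Hz).
  move=> g; rewrite !inE => /orP [] /eqP ->; eexists; split; try reflexivity.
    exact: kills_gy.
  exact: kills_gzc.
move=> a H.
have Hnonneg j : 0 <= j -> (gcoef a j).[- c] = 0.
  case: j => [k|//] _; have /eqP := H k; rewrite scaler_eq0 => /orP [/eqP //|/eqP H0].
  by exfalso; apply: (iter_ax_neq0 u0 Hz _ H0) => i _; apply: Hnz.
pose S := undup (map fst a).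
exists [:: [seq (j - (-1), shiftp 1 (gcoef a j)) | j <- [seq j <- S | j < 0]];
           [seq (j - 0, gcoef a j %/ ('X + c%:P)) | j <- [seq j <- S | 0 <= j]]].
split => // m; rewrite /= !gcoef_cat gcoef_nil !addr0.
rewrite -!gmul_single !gcoef_gmul_map ?filter_uniq ?undup_uniq // !mem_filter.
case: (boolP (m \in S)) => mS; last first.
  by rewrite !andbF add0r gcoef_notin // -mem_undup.
rewrite !andbT; case: (ltrP m 0) => Hm.
  by rewrite addr0 shiftpK wcoef_nn ?mulr1 ?mul1r //; lia.
by rewrite add0r shiftp0 subr0 wcoef_pp // mulr1 mulXaddC_divp // Hnonneg.
Qed.

Lemma iso_cyc_gypow (k : nat) n (u : V) : gsimple M -> (0 < k)%N -> u <> 0 ->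
  ghom n u -> az u = 0 -> ax u = 0 -> iter k (@ay _ _ M) u = 0 -> f.[0] = 0 ->
  f.[- k%:R] = 0 -> (forall i : nat, (i.+1 < k)%N -> f.[- i%:R - 1] <> 0) ->
  iso_cyc M [:: gypow K k; gx K; gzc 0] n.
Proof.
move=> Hs k0 u0 Hu Hz Hx Hy Hf0 Hfk Hnz.
have Hz' : az u = 0 *: u by rewrite scale0r.
apply: (iso_cyc_eigen Hs u0 Hu Hz').
  move=> g; rewrite !inE => /orP [/eqP ->|/orP [] /eqP ->]; eexists; split; try reflexivity.
  - exact: kills_gypow.
  - exact: kills_gx.
  - by have := kills_gzc 0 u; rewrite oppr0.
move=> a H.
have Hmid j : - k%:Z < j -> j <= 0 -> (gcoef a j).[0] = 0.
  move=> Hj1 Hj2; have /eqP := H j; rewrite scaler_eq0 => /orP [/eqP //|/eqP H0].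
  exfalso; move: H0; rewrite (_ : j = - `|j|%N%:Z) ?actwN; last by lia.
  apply: (iter_ay_neq0 u0 Hz') => i Hi; rewrite sub0r; apply: Hnz; lia.
pose S := undup (map fst a).
exists [:: [seq (j - (- k%:Z), shiftp k%:Z (gcoef a j)) | j <- [seq j <- S | j <= - k%:Z]];
           [seq (j - 1, shiftp (-1) (gcoef a j)) | j <- [seq j <- S | 0 < j]];
           [seq (j - 0, gcoef a j %/ ('X + 0%:P)) | j <- [seq j <- S | (- k%:Z < j) && (j <= 0)]]].
split => // m; rewrite [flatten _]/= !gcoef_cat gcoef_nil !addr0.
rewrite -!gmul_single !gcoef_gmul_map ?filter_uniq ?undup_uniq // !mem_filter.
case: (boolP (m \in S)) => mS; last first.
  by rewrite !andbF !add0r gcoef_notin // -mem_undup.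
rewrite !andbT; case: (lerP m (- k%:Z)) => H1.
  rewrite (_ : (0 < m) = false) /=; last by apply/negbTE; rewrite -leNgt; lia.
  by rewrite add0r shiftpK wcoef_nn ?mulr1 ?mul1r ?addr0 //; lia.
case: (ltrP 0 m) => H2 /=.
  by rewrite add0r shiftpKV wcoef_pp ?mulr1 ?mul1r ?addr0 //; lia.
rewrite !add0r shiftp0 subr0 wcoef_nn // mulr1.
by have := @mulXaddC_divp _ (gcoef a m) 0; rewrite polyC0 addr0 oppr0 => ->; last exact: Hmid.
Qed.

Lemma iso_cyc_gzc lam (u : V) : gsimple M -> u <> 0 -> ghom 0 u ->
  az u = (- lam) *: u -> (forall t : int, f.[- lam + t%:~R] <> 0) ->
  iso_cyc M [:: gzc lam] 0.
Proof.
move=> Hs u0 Hu Hz Hnz; apply: (iso_cyc_eigen Hs u0 Hu Hz).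
  by move=> g; rewrite !inE => /eqP ->; eexists; split; [reflexivity | exact: kills_gzc].
move=> a H.
have Hall j : (gcoef a j).[- lam] = 0.
  have /eqP := H j; rewrite scaler_eq0 => /orP [/eqP //|/eqP H0]; exfalso.
  case: j H0 => k H0.
    by apply: (iter_ax_neq0 u0 Hz _ H0) => i _; apply: (Hnz i).
  rewrite -[Negz k]opprK NegzE actwN in H0.
  apply: (iter_ay_neq0 u0 Hz _ H0) => i _.
  by rewrite (_ : - lam - i%:R - 1 = - lam + (- (i.+1)%:Z)%:~R) //; ring.
pose S := undup (map fst a).
exists [:: [seq (j - 0, gcoef a j %/ ('X + lam%:P)) | j <- S]].
split => // m; rewrite /= gcoef_cat gcoef_nil addr0 /gzc.
rewrite gcoef_gmul_map ?undup_uniq //.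
case: (boolP (m \in S)) => mS; last by rewrite gcoef_notin // -mem_undup.
by rewrite shiftp0 subr0 wcoef0l mulr1 mulXaddC_divp // Hall.
Qed.

End Presentations.

Section Char0.
Variable K : fieldType.
Hypothesis hK : [pchar K] =i pred0.

Lemma pchar0_intr_eq0 (z : int) : (z%:~R == 0 :> K) = (z == 0).
Proof.
have H := (pcharf0P K).1 hK.
by case: z => n; rewrite ?NegzE ?mulrNz ?oppr_eq0 [_%:~R]/= H.
Qed.

Lemma pchar0_intr_inj (x y : int) : (x%:~R : K) = y%:~R -> x = y.
Proof. by move/eqP; rewrite -subr_eq0 -intrB pchar0_intr_eq0 subr_eq0 => /eqP. Qed.

Lemma pchar0_intr_neq0 (z : int) : z != 0 -> (z%:~R : K) <> 0.
Proof. by move=> z0 /eqP; rewrite pchar0_intr_eq0 (negbTE z0). Qed.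

Lemma pchar0_intr_gap (z c : int) (e : K) : z%:~R = e -> e = c%:~R -> z = c.
Proof. by move=> <- /pchar0_intr_inj. Qed.

End Char0.

Lemma not_intK_add (K : fieldType) (x : K) (z : int) :
  ~ is_intK x -> ~ is_intK (x + z%:~R).
Proof. by move=> H [w Hw]; apply: H; exists (w - z); rewrite intrB -Hw addrK. Qed.

Lemma not_intK_neq0 (K : fieldType) (x : K) : ~ is_intK x -> x <> 0.
Proof. by move=> H x0; apply: H; exists 0; rewrite x0. Qed.

Section Fpol.
Variables (K : fieldType) (alpha : K).
Local Notation f := (fpol alpha).

Lemma horner_fpol x : f.[x] = x * (x + alpha).
Proof. by rewrite /fpol !hornerE. Qed.

Lemma fpol_root0 : f.[0] = 0.
Proof. by rewrite horner_fpol mul0r. Qed.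

Lemma fpol_rootN : f.[- alpha] = 0.
Proof. by rewrite horner_fpol addNr mulr0. Qed.

Lemma horner_fpol_neq0 x : x <> 0 -> x + alpha <> 0 -> f.[x] <> 0.
Proof. by rewrite horner_fpol => /eqP x0 /eqP xa /eqP; rewrite mulf_eq0 (negbTE x0) (negbTE xa). Qed.

End Fpol.

Section Generators.
Variables (K : fieldType) (alpha : K) (M : grmod alpha).
Local Notation V := (gV M).

Record gen_data := GenData {
  gd_deg : int; gd_eig : K; gd_xkill : bool; gd_ykill : bool }.

Definition is_generator (m : V) (D : gen_data) :=
  [/\ ghom (gd_deg D) m, m <> 0, forall v, exists a, v = act a m,
      az m = gd_eig D *: m & (gd_xkill D -> ax m = 0) /\ (gd_ykill D -> ay m = 0)].

Definition gen_data_compat (D1 D2 : gen_data) :=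
  [/\ ((gd_deg D2 - gd_deg D1)%:~R : K) = gd_eig D2 - gd_eig D1,
      gd_xkill D1 -> gd_deg D2 <= gd_deg D1, gd_ykill D1 -> gd_deg D1 <= gd_deg D2,
      gd_xkill D2 -> gd_deg D1 <= gd_deg D2 & gd_ykill D2 -> gd_deg D2 <= gd_deg D1].

Lemma act_gx (m : V) : act (gx K) m = ax m.
Proof. by rewrite act_single peval_op1. Qed.

Lemma act_gy (m : V) : act (gy K) m = ay m.
Proof. by rewrite act_single peval_op1. Qed.

Lemma act_gzc c (m : V) : act (gzc c) m = az m + c *: m.
Proof. by rewrite act_single /= peval_opD peval_opX peval_opC. Qed.

Lemma iso_cyc_generator gens n c (xk yk : bool) : gsimple M -> iso_cyc M gens n ->
  in_rideal alpha gens (gzc c) -> (xk -> in_rideal alpha gens (gx K)) ->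
  (yk -> in_rideal alpha gens (gy K)) -> exists m, is_generator m (GenData n (- c) xk yk).
Proof.
move=> [[v0 v00] _] [m [Hm [Hsurj Hker]]] Hz Hx Hy; exists m; split => //.
- by move=> m0; have [a Ha] := Hsurj v0; apply: v00; rewrite Ha m0 linear0.
- by move/Hker: Hz; rewrite act_gzc => /eqP; rewrite addr_eq0 -scaleNr => /eqP.
- by split=> [/Hx|/Hy] /Hker; rewrite ?act_gx ?act_gy.
Qed.

(* [m2] is a multiple of [m1 . w_(n2 - n1)], and conversely. *)
Lemma generator_shift (m1 m2 : V) D1 D2 : is_generator m1 D1 -> is_generator m2 D2 ->
  gd_eig D2 = gd_eig D1 + (gd_deg D2 - gd_deg D1)%:~R /\
  actw (gd_deg D2 - gd_deg D1) m1 <> 0.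
Proof.
move=> [H1 _ S1 Z1 _] [H2 N2 _ Z2 _]; have [a Ha] := S1 m2.
have H2' : ghom (gd_deg D1 + (gd_deg D2 - gd_deg D1)) m2 by rewrite addrC subrK.
have := act_homogeneous_component H1 Ha H2'.
rewrite (peval_op_eigen _ Z1) linearZ /= => E.
have e0 : actw (gd_deg D2 - gd_deg D1) m1 <> 0 by move=> e0; apply: N2; rewrite E e0 scaler0.
split => //; have : az m2 = (gd_eig D1 + (gd_deg D2 - gd_deg D1)%:~R) *: m2.
  by rewrite E linearZ /= (az_actw_eigen _ Z1) !scalerA mulrC.
rewrite Z2 => /eqP; rewrite -subr_eq0 -scalerBl scaler_eq0 subr_eq0.
by case/orP => /eqP // /N2.
Qed.

Lemma actw_ax_eq0 (m : V) j : ax m = 0 -> 0 < j -> actw j m = 0.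
Proof.
move=> Hx Hj; rewrite (_ : j = `|j|.-1.+1); last by lia.
by rewrite actwP iterSr Hx linear0.
Qed.

Lemma actw_ay_eq0 (m : V) j : ay m = 0 -> j < 0 -> actw j m = 0.
Proof. by case: j => // k Hy _; rewrite [actw _ _]iterSr Hy linear0. Qed.

Lemma generators_compat (m1 m2 : V) D1 D2 :
  is_generator m1 D1 -> is_generator m2 D2 -> gen_data_compat D1 D2.
Proof.
move=> G1 G2; have [E A1] := generator_shift G1 G2.
have [_ A2] := generator_shift G2 G1.
case: G1 => _ _ _ _ [X1 Y1]; case: G2 => _ _ _ _ [X2 Y2].
split; first by rewrite E; ring.
- move=> /X1 H; case: lerP => // Hn; exfalso; apply: A1.
  by apply: actw_ax_eq0 => //; rewrite subr_gt0.
- move=> /Y1 H; case: lerP => // Hn; exfalso; apply: A1.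
  by apply: actw_ay_eq0 => //; rewrite subr_lt0.
- move=> /X2 H; case: lerP => // Hn; exfalso; apply: A2.
  by apply: actw_ax_eq0 => //; rewrite subr_gt0.
- move=> /Y2 H; case: lerP => // Hn; exfalso; apply: A2.
  by apply: actw_ay_eq0 => //; rewrite subr_lt0.
Qed.

Lemma exists_unique_presentation (L : Type) (valid iso : L -> Prop)
    (data : L -> gen_data) :
  (forall l, iso l -> exists m, is_generator m (data l)) ->
  (forall l1 l2, valid l1 -> valid l2 -> gen_data_compat (data l1) (data l2) -> l1 = l2) ->
  (exists l, valid l /\ iso l) -> exists! l, valid l /\ iso l.
Proof.
move=> Hgen Hcompat [l [Hv Hi]]; exists l; split => // l' [Hv' Hi'].
have [m1 G1] := Hgen l Hi; have [m2 G2] := Hgen l' Hi'.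
exact: Hcompat Hv Hv' (generators_compat G1 G2).
Qed.

End Generators.

Section Existence.
Variables (K : fieldType) (alpha : K) (M : grmod alpha).
Local Notation V := (gV M).
Local Notation f := (fpol alpha).
Variables (d : int) (mu : K) (u : V).
Hypotheses (Hs : gsimple M) (u0 : u <> 0) (Hu : ghom d u) (Hz : az u = mu *: u).

(* Raising [u] by [x^t] to a root [-c] of [f] gives a vector killed by [x];
   no intermediate [x] kills it because [f] has no root strictly between. *)
Lemma exists_iso_cyc_gx c (t : nat) : mu + t%:R = - c -> f.[- c] = 0 ->
  (forall i : nat, f.[- c - i%:R - 1] <> 0) -> iso_cyc M [:: gx K; gzc c] (d + t%:Z).
Proof.
move=> Ht Hf Hnz.
have A : iter t (@ax _ _ M) u <> 0.
  apply: (iter_ax_neq0 u0 Hz) => i Hi.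
  by rewrite (_ : mu + i%:R = - c - (t - i.+1)%:R - 1); [apply: Hnz | rewrite natrB // -Ht; ring].
have B := iter_ax_ghom t Hu.
have C := az_iter_ax_eigen t Hz; rewrite Ht in C.
exact: iso_cyc_gx Hs A B C (simple_ax_eq0 Hs A B C Hf) Hf Hnz.
Qed.

Lemma exists_iso_cyc_gy c (t : nat) : mu - t%:R = - c -> f.[- c - 1] = 0 ->
  (forall i : nat, f.[- c + i%:R] <> 0) -> iso_cyc M [:: gy K; gzc c] (d - t%:Z).
Proof.
move=> Ht Hf Hnz.
have A : iter t (@ay _ _ M) u <> 0.
  apply: (iter_ay_neq0 u0 Hz) => i Hi.
  by rewrite (_ : mu - i%:R - 1 = - c + (t - i.+1)%:R); [apply: Hnz | rewrite natrB // -Ht; ring].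
have B := iter_ay_ghom t Hu.
have C := az_iter_ay_eigen t Hz; rewrite Ht in C.
exact: iso_cyc_gy Hs A B C (simple_ay_eq0 Hs A B C Hf) Hf Hnz.
Qed.

Lemma exists_iso_cyc_gypow (k t : nat) : (0 < k)%N -> (t < k)%N -> mu + t%:R = 0 ->
  f.[0] = 0 -> f.[- k%:R] = 0 -> (forall i : nat, (i.+1 < k)%N -> f.[- i%:R - 1] <> 0) ->
  iso_cyc M [:: gypow K k; gx K; gzc 0] (d + t%:Z).
Proof.
move=> k0 tk Ht Hf0 Hfk Hnz.
have A : iter t (@ax _ _ M) u <> 0.
  apply: (iter_ax_neq0 u0 Hz) => i Hi.
  rewrite (_ : mu + i%:R = - (t - i.+1)%:R - 1); last by rewrite natrB // -(subr0 mu) -Ht; ring.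
  by apply: Hnz; lia.
have B := iter_ax_ghom t Hu.
have C := az_iter_ax_eigen t Hz; rewrite Ht in C.
have C0 : az (iter t (@ax _ _ M) u) = 0 by rewrite C scale0r.
exact: iso_cyc_gypow Hs k0 A B C0 (simple_ax_eq0 Hs A B C Hf0)
  (simple_iter_ay_eq0 Hs A B C0 Hfk k0) Hf0 Hfk Hnz.
Qed.

(* Away from the roots of [f], [x] and [y] act injectively, so [u] can be moved
   to degree [0]. *)
Lemma exists_iso_cyc_gzc : (forall z : int, f.[mu + z%:~R] <> 0) ->
  iso_cyc M [:: gzc (d%:~R - mu)] 0.
Proof.
move=> Hnz.
suff [u' [u'0 Hu' Hz']] : exists u' : V, [/\ u' <> 0, ghom 0 u' & az u' = (mu - d%:~R) *: u'].
  apply: (iso_cyc_gzc Hs u'0 Hu'); first by rewrite Hz'; congr (_ *: _); ring.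
  by move=> z; rewrite (_ : _ + _ = mu + (z - d)%:~R); [apply: Hnz | rewrite intrB; ring].
case: d Hu => t Hd.
  exists (iter t (@ay _ _ M) u); split.
  - apply: (iter_ay_neq0 u0 Hz) => i _.
    by rewrite (_ : _ - _ = mu + (- (i.+1)%:Z)%:~R); [apply: Hnz | ring].
  - by have := iter_ay_ghom t Hd; rewrite subrr.
  - exact: az_iter_ay_eigen.
exists (iter t.+1 (@ax _ _ M) u); split.
- by apply: (iter_ax_neq0 u0 Hz) => i _; apply: (Hnz i).
- by have := iter_ax_ghom t.+1 Hd; rewrite NegzE addNr.
- by rewrite (az_iter_ax_eigen _ Hz) NegzE mulrNz opprK.
Qed.

End Existence.

Lemma eq_of_subr_eq (K : fieldType) (x y a b : K) : a = b -> x - y = a - b -> x = y.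
Proof. by move=> -> /eqP; rewrite subrr subr_eq0 => /eqP. Qed.

Ltac rideal_member :=
  first [ by case | move=> *]; first [ exact: in_rideal_head
                  | apply: in_rideal_cons; exact: in_rideal_head
                  | do 2 apply: in_rideal_cons; exact: in_rideal_head ].

Ltac solve_by_gap Hk :=
  first [ apply: (eq_of_subr_eq Hk); ring
        | apply: (eq_of_subr_eq (esym Hk)); ring ].

(* [Hk] says that the degree gap is the integer [c] (in [K], of characteristic
   [0]); the orientation constraints coming from [x]/[y]-killing then decide. *)
Tactic Notation "degree_gap" constr(hK) hyp(Hk) uconstr(c) :=
  match type of Hk with (?z)%:~R = _ =>
    have : z = c by apply: (pchar0_intr_gap hK Hk); ring end; move=> ?;
  repeat match goal with H : true -> _ |- _ => specialize (H isT) end;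
  first [ f_equal; lia | exfalso; lia ].

Ltac not_int v Hk w := exfalso; apply: v; exists w; solve_by_gap Hk.

Lemma int_nonpos_eq (j : int) : j <= 0 -> exists t : nat, j = - t%:Z.
Proof. by move=> Hj; exists `|j|%N; lia. Qed.

Lemma int_pos_eq (j : int) : 0 < j -> exists t : nat, j = t.+1%:Z.
Proof. by move=> Hj; exists `|j|.-1; lia. Qed.

Lemma fpol_int_neq0 (K : fieldType) (hK : [pchar K] =i pred0) (alpha : K) (w z : int) :
  alpha = w%:~R -> z != 0 -> z + w != 0 -> (fpol alpha).[z%:~R] <> 0.
Proof.
move=> -> z0 zw; apply: horner_fpol_neq0; rewrite -?intrD; exact: (pchar0_intr_neq0 hK).
Qed.

Section CaseZero.
Variables (K : closedFieldType) (hK : [pchar K] =i pred0).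

Definition data1 (l : lab1 K) : gen_data K :=
  match l with
  | L1X n => GenData n (- 0) true false
  | L1Y n => GenData (n + 1) (- (-1)) false true
  | L1M lam => GenData 0 (- lam) false false
  end.

Lemma lab1_generator (M : grmod (0 : K)) l : gsimple M -> iso1 M l ->
  exists m : gV M, is_generator m (data1 l).
Proof. by case: l => [n|n|lam] Hs H /=; apply: (iso_cyc_generator Hs H); rideal_member. Qed.

Lemma lab1_compat_eq l1 l2 : valid1 l1 -> valid1 l2 ->
  gen_data_compat (data1 l1) (data1 l2) -> l1 = l2.
Proof.
case: l1 => [n1|n1|l1]; case: l2 => [n2|n2|l2] v1 v2 [/= Hk X1 Y1 X2 Y2].
- by degree_gap hK Hk 0.
- by degree_gap hK Hk 1.
- by not_int v2 Hk n1.
- by degree_gap hK Hk (-1).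
- by degree_gap hK Hk 0.
- by not_int v2 Hk n1.
- by not_int v1 Hk n2.
- by not_int v1 Hk n2.
- by congr L1M; solve_by_gap Hk.
Qed.

Lemma exists_lab1 (M : grmod (0 : K)) : gsimple M -> exists l, valid1 l /\ iso1 M l.
Proof.
move=> Hs; have [u [d [mu [u0 Hu Hz]]]] := simple_exists_eigen Hs.
have fint := fpol_int_neq0 hK (esym (mulr0z (1 : K))).
case: (classic (is_intK mu)) => [[k Hk]|Hnk]; last first.
  exists (L1M (d%:~R - mu)); split; last first.
    apply: (exists_iso_cyc_gzc Hs u0 Hu Hz) => z.
    by apply: horner_fpol_neq0; rewrite ?addr0; apply/not_intK_neq0/not_intK_add.
  by move=> [w Hw]; apply: Hnk; exists (d - w); rewrite intrB -Hw; ring.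
case: (lerP k 0) => [/int_nonpos_eq [t Ht]|/int_pos_eq [t Ht]]; subst k.
  exists (L1X K (d + t%:Z)); split => //=.
  apply: (exists_iso_cyc_gx Hs u0 Hu Hz); first by rewrite Hk; ring.
    by rewrite oppr0 fpol_root0.
  by move=> i; rewrite (_ : _ - _ = (- (i.+1)%:Z)%:~R); [apply: fint; lia | ring].
exists (L1Y K (d - t%:Z - 1)); split => //=; rewrite subrK.
apply: (exists_iso_cyc_gy Hs u0 Hu Hz); first by rewrite Hk; ring.
  by rewrite opprK subrr fpol_root0.
by move=> i; rewrite (_ : _ + _ = (i.+1%:Z)%:~R); [apply: fint; lia | ring].
Qed.

End CaseZero.

Section CasePositive.
Variables (K : closedFieldType) (hK : [pchar K] =i pred0) (a : nat).
Hypothesis a0 : (0 < a)%N.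

Definition data2 (l : lab2 K) : gen_data K :=
  match l with
  | L2X n => GenData (n - a%:Z) (- a%:R) true false
  | L2Y n => GenData (n + 1) (- (-1)) false true
  | L2Z n => GenData n (- 0) true false
  | L2M lam => GenData 0 (- lam) false false
  end.

Lemma lab2_generator (M : grmod (a%:R : K)) l : gsimple M -> iso2 M l ->
  exists m : gV M, is_generator m (data2 l).
Proof. by case: l => [n|n|n|lam] Hs H /=; apply: (iso_cyc_generator Hs H); rideal_member. Qed.

Lemma lab2_compat_eq l1 l2 : valid2 l1 -> valid2 l2 ->
  gen_data_compat (data2 l1) (data2 l2) -> l1 = l2.
Proof.
case: l1 => [n1|n1|n1|l1]; case: l2 => [n2|n2|n2|l2] v1 v2 [/= Hk X1 Y1 X2 Y2].
- by degree_gap hK Hk 0.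
- by degree_gap hK Hk (1 + a%:Z).
- by degree_gap hK Hk a%:Z.
- by not_int v2 Hk n1.
- by degree_gap hK Hk (- a%:Z - 1).
- by degree_gap hK Hk 0.
- by degree_gap hK Hk (-1).
- by not_int v2 Hk n1.
- by degree_gap hK Hk (- a%:Z).
- by degree_gap hK Hk 1.
- by degree_gap hK Hk 0.
- by not_int v2 Hk n1.
- by not_int v1 Hk n2.
- by not_int v1 Hk n2.
- by not_int v1 Hk n2.
- by congr L2M; solve_by_gap Hk.
Qed.

Lemma exists_lab2 (M : grmod (a%:R : K)) : gsimple M -> exists l, valid2 l /\ iso2 M l.
Proof.
move=> Hs; have [u [d [mu [u0 Hu Hz]]]] := simple_exists_eigen Hs.
have Ha : (a%:R : K) = (a%:Z)%:~R by [].
have fint := fpol_int_neq0 hK Ha.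
case: (classic (is_intK mu)) => [[k Hk]|Hnk]; last first.
  exists (L2M (d%:~R - mu)); split; last first.
    apply: (exists_iso_cyc_gzc Hs u0 Hu Hz) => z.
    apply: horner_fpol_neq0; first exact/not_intK_neq0/not_intK_add.
    by rewrite Ha -addrA -intrD; apply/not_intK_neq0/not_intK_add.
  by move=> [w Hw]; apply: Hnk; exists (d - w); rewrite intrB -Hw; ring.
case: (lerP k (- a%:Z)) => Hka.
  have [t Ht] : exists t : nat, k = - t%:Z - a%:Z by exists (absz (k + a%:Z)); lia.
  exists (L2X K (d + t%:Z + a%:Z)); split => //=; rewrite addrK.
  apply: (exists_iso_cyc_gx Hs u0 Hu Hz); first by rewrite Hk Ht Ha; ring.
    exact: fpol_rootN.
  by move=> i; rewrite (_ : _ - _ = (- (i.+1)%:Z - a%:Z)%:~R); [apply: fint; lia | ring].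
case: (lerP k 0) => [/int_nonpos_eq [t Ht]|/int_pos_eq [t Ht]]; subst k.
  exists (L2Z K (d + t%:Z)); split => //=.
  apply: (exists_iso_cyc_gypow Hs u0 Hu Hz a0); [lia | by rewrite Hk; ring | | | ].
  - exact: fpol_root0.
  - exact: fpol_rootN.
  - by move=> i Hi; rewrite (_ : _ - _ = (- (i.+1)%:Z)%:~R); [apply: fint; lia | ring].
exists (L2Y K (d - t%:Z - 1)); split => //=; rewrite subrK.
apply: (exists_iso_cyc_gy Hs u0 Hu Hz); first by rewrite Hk; ring.
  by rewrite opprK subrr fpol_root0.
by move=> i; rewrite (_ : _ + _ = (i.+1%:Z)%:~R); [apply: fint; lia | ring].
Qed.

End CasePositive.

Section CaseNonInteger.
Variables (K : closedFieldType) (hK : [pchar K] =i pred0) (alpha : K).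
Hypothesis Hal : ~ is_intK alpha.
Local Notation f := (fpol alpha).

Definition data3 (l : lab3 K) : gen_data K :=
  match l with
  | L3X0 n => GenData n (- 0) true false
  | L3Y0 n => GenData (n + 1) (- (-1)) false true
  | L3Xa n => GenData n (- alpha) true false
  | L3Ya n => GenData (n + 1) (- (alpha - 1)) false true
  | L3M lam => GenData 0 (- lam) false false
  end.

Lemma lab3_generator (M : grmod alpha) l : gsimple M -> iso3 M l ->
  exists m : gV M, is_generator m (data3 l).
Proof. by case: l => [n|n|n|n|lam] Hs H /=; apply: (iso_cyc_generator Hs H); rideal_member. Qed.

Lemma lab3_compat_eq l1 l2 : valid3 alpha l1 -> valid3 alpha l2 ->
  gen_data_compat (data3 l1) (data3 l2) -> l1 = l2.
Proof.
case: l1 => [n1|n1|n1|n1|l1]; case: l2 => [n2|n2|n2|n2|l2] v1 v2 [/= Hk X1 Y1 X2 Y2];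
  try case: v1 => v1 v1'; try case: v2 => v2 v2'.
- by degree_gap hK Hk 0.
- by degree_gap hK Hk 1.
- by not_int Hal Hk (n1 - n2).
- by not_int Hal Hk (n1 - n2).
- by not_int v2 Hk n1.
- by degree_gap hK Hk (-1).
- by degree_gap hK Hk 0.
- by not_int Hal Hk (n1 - n2).
- by not_int Hal Hk (n1 - n2).
- by not_int v2 Hk n1.
- by not_int Hal Hk (n2 - n1).
- by not_int Hal Hk (n2 - n1).
- by degree_gap hK Hk 0.
- by degree_gap hK Hk 1.
- by not_int v2' Hk n1.
- by not_int Hal Hk (n2 - n1).
- by not_int Hal Hk (n2 - n1).
- by degree_gap hK Hk (-1).
- by degree_gap hK Hk 0.
- by not_int v2' Hk n1.
- by not_int v1 Hk n2.
- by not_int v1 Hk n2.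
- by not_int v1' Hk n2.
- by not_int v1' Hk n2.
- by congr L3M; solve_by_gap Hk.
Qed.

Lemma fpol_int_neq0_nonint (z : int) : z != 0 -> f.[z%:~R] <> 0.
Proof.
move=> z0; apply: horner_fpol_neq0; first exact: (pchar0_intr_neq0 hK).
by rewrite addrC; apply/not_intK_neq0/not_intK_add.
Qed.

Lemma fpol_shift_neq0_nonint (z : int) : z != 0 -> f.[z%:~R - alpha] <> 0.
Proof.
move=> z0; apply: horner_fpol_neq0; last by rewrite subrK; apply: (pchar0_intr_neq0 hK).
apply/not_intK_neq0 => -[w Hw]; apply: Hal; exists (z - w).
by rewrite intrB -Hw; ring.
Qed.

Lemma exists_lab3 (M : grmod alpha) : gsimple M -> exists l, valid3 alpha l /\ iso3 M l.
Proof.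
move=> Hs; have [u [d [mu [u0 Hu Hz]]]] := simple_exists_eigen Hs.
have fint := fpol_int_neq0_nonint; have fshift := fpol_shift_neq0_nonint.
case: (classic (is_intK mu)) => [[k Hk]|Hnk].
  case: (lerP k 0) => [/int_nonpos_eq [t Ht]|/int_pos_eq [t Ht]]; subst k.
    exists (L3X0 K (d + t%:Z)); split => //=.
    apply: (exists_iso_cyc_gx Hs u0 Hu Hz); first by rewrite Hk; ring.
      by rewrite oppr0 fpol_root0.
    by move=> i; rewrite (_ : _ - _ = (- (i.+1)%:Z)%:~R); [apply: fint | ring].
  exists (L3Y0 K (d - t%:Z - 1)); split => //=; rewrite subrK.
  apply: (exists_iso_cyc_gy Hs u0 Hu Hz); first by rewrite Hk; ring.
    by rewrite opprK subrr fpol_root0.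
  by move=> i; rewrite (_ : _ + _ = (i.+1%:Z)%:~R); [apply: fint | ring].
case: (classic (is_intK (mu + alpha))) => [[k Hk]|Hnka].
  case: (lerP k 0) => [/int_nonpos_eq [t Ht]|/int_pos_eq [t Ht]]; subst k.
    exists (L3Xa K (d + t%:Z)); split => //=.
    apply: (exists_iso_cyc_gx Hs u0 Hu Hz); first by rewrite -[mu](addrK alpha) Hk; ring.
      exact: fpol_rootN.
    by move=> i; rewrite (_ : _ - _ = (- (i.+1)%:Z)%:~R - alpha); [apply: fshift | ring].
  exists (L3Ya K (d - t%:Z - 1)); split => //=; rewrite subrK.
  apply: (exists_iso_cyc_gy Hs u0 Hu Hz); first by rewrite -[mu](addrK alpha) Hk; ring.
    by rewrite (_ : _ - 1 = - alpha) ?fpol_rootN //; ring.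
  by move=> i; rewrite (_ : _ + _ = (i.+1%:Z)%:~R - alpha); [apply: fshift | ring].
exists (L3M (d%:~R - mu)); split; last first.
  apply: (exists_iso_cyc_gzc Hs u0 Hu Hz) => z.
  apply: horner_fpol_neq0; first exact/not_intK_neq0/not_intK_add.
  by rewrite addrAC; apply/not_intK_neq0/not_intK_add.
by split=> -[w Hw]; [apply: Hnk | apply: Hnka]; exists (d - w);
  rewrite intrB -Hw; ring.
Qed.

End CaseNonInteger.

Theorem lemma3p1 (K : closedFieldType) (hK : [pchar K] =i pred0) :
  (forall M : grmod (0 : K), gfg M -> gsimple M ->
     exists! l : lab1 K, valid1 l /\ iso1 M l) /\
  (forall a : nat, (0 < a)%N -> forall M : grmod (a%:R : K), gfg M -> gsimple M ->
     exists! l : lab2 K, valid2 l /\ iso2 M l) /\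
  (forall alpha : K, ~ is_intK alpha -> forall M : grmod alpha, gfg M -> gsimple M ->
     exists! l : lab3 K, valid3 alpha l /\ iso3 M l).
Proof.
split; [|split].
- move=> M _ Hs; apply: (@exists_unique_presentation _ _ M _ _ _ (@data1 K)).
  + by move=> l; apply: lab1_generator.
  + exact: lab1_compat_eq.
  + exact: exists_lab1.
- move=> a a0 M _ Hs; apply: (@exists_unique_presentation _ _ M _ _ _ (@data2 K a)).
  + by move=> l; apply: lab2_generator.
  + exact: lab2_compat_eq.
  + exact: exists_lab2.
- move=> alpha Hal M _ Hs; apply: (@exists_unique_presentation _ _ M _ _ _ (data3 alpha)).
  + by move=> l; apply: lab3_generator.
  + exact: lab3_compat_eq.
  + exact: exists_lab3.
Qed.
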